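(* Consider the periodic MIMO broadband power line communications (BB-PLC) channel with $\tilde n_r$ outputs, $\tilde n_t$ inputs, memory $\tilde m$ and period $\tilde p$, $$\tilde{\mathbf Y}[i]=\sum_{\tau=0}^{\tilde m}\tilde{\mathsf G}[i,\tau]\,\tilde{\mathbf X}[i-\tau]+\tilde{\mathbf W}[i],\qquad i\in\{0,1,\ldots,\tilde l-1\},$$ with input subject to the time-averaged power constraint $\frac1{\tilde l}\sum_{i=0}^{\tilde l-1}\mathbb E\{\|\tilde{\mathbf X}[i]\|^2\}\le\tilde P$, and let $C_{\rm PLC}$ be its capacity (in bits per channel use). Let $C_{\rm DCD}$ be the capacity of the $\tilde p\tilde n_r\times\tilde p\tilde n_t$ time-invariant MIMO channel $$\mathbf Y_{\rm DCD}[\tilde i]=\sum_{\tilde\tau=0}^{1}\mathsf G_{\rm DCD}[\tilde\tau]\,\mathbf X_{\rm DCD}[\tilde i-\tilde\tau]+\mathbf W_{\rm DCD}[\tilde i],\qquad \tilde i\in\{0,1,\ldots,l-1\},$$ with input subject to $\frac1l\sum_{\tilde i=0}^{l-1}\mathbb E\{\|\mathbf X_{\rm DCD}[\tilde i]\|^2\}\le\tilde p\cdot\tilde P$. Then $$C_{\rm PLC}=\frac1{\tilde p}\,C_{\rm DCD}.$$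
   Context: All signals are real-valued and in discrete time; logarithms are base 2. For a sequence $\mathbf y[i]$, $\mathbf y_{a}^{b}$ is the column vector stacking $\mathbf y[a],\ldots,\mathbf y[b]$, and $\mathbf y^{b}=\mathbf y_0^b$. BB-PLC channel. $\tilde m\ge0$ is an integer; $\tilde p_{\mathsf G},\tilde p_{\mathbf W}$ are positive integers. The channel matrices $\tilde{\mathsf G}[i,\tau]\in\mathbb R^{\tilde n_r\times\tilde n_t}$, $0\le\tau\le\tilde m$, satisfy $\tilde{\mathsf G}[i,\tau]=\tilde{\mathsf G}[i+\tilde p_{\mathsf G},\tau]$ for all $i\in\mathbb Z$. The noise $\tilde{\mathbf W}[i]\in\mathbb R^{\tilde n_r}$ is a zero-mean (non-Gaussian) strict-sense cyclostationary process with period $\tilde p_{\mathbf W}$ (all finite-dimensional joint PDFs are invariant under a time shift by $\tilde p_{\mathbf W}$), independent of the transmitted message, and such that $\tilde{\mathbf W}_{i_1}^{i_1+l_1}$ and $\tilde{\mathbf W}_{i_2}^{i_2+l_2}$ are independent whenever $i_2>i_1+l_1+\tilde m$; no $\tilde{\mathbf W}[i_0]$ can be expressed as a linear combination of $\{\tilde{\mathbf W}[i]\}_{i\ne i_0}$. The period $\tilde p$ of the channel is the smallest common multiple of $\tilde p_{\mathsf G}$ and $\tilde p_{\mathbf W}$ that satisfies $\tilde p>\tilde m$. The initial state is $\tilde{\mathbf S}_0=[(\tilde{\mathbf X}_{-\tilde m}^{-1})^T,(\tilde{\mathbf W}_{-\tilde m}^{-1})^T]^T$. Time-invariant channel. $\mathbf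 W_{\rm DCD}[\tilde i]=\tilde{\mathbf W}_{\tilde i\tilde p}^{(\tilde i+1)\tilde p-1}$. $\mathsf G_{\rm DCD}[0],\mathsf G_{\rm DCD}[1]$ are $\tilde p\times\tilde p$ block matrices with blocks of size $\tilde n_r\times\tilde n_t$, indexed by $a,b\in\{0,\ldots,\tilde p-1\}$: block $(a,b)$ of $\mathsf G_{\rm DCD}[0]$ is $\tilde{\mathsf G}[a,a-b]$ if $0\le a-b\le\tilde m$ and $0$ otherwise; block $(a,b)$ of $\mathsf G_{\rm DCD}[1]$ is $\tilde{\mathsf G}[a,\tilde p+a-b]$ if $1\le\tilde p+a-b\le\tilde m$ and $0$ otherwise. Its initial state is $[\mathbf X_{\rm DCD}^T[-1],\mathbf W_{\rm DCD}^T[-1]]^T$. Capacity. For a channel with input in $\mathbb R^{n_t}$, output in $\mathbb R^{n_r}$ and initial state $\mathbf S_0\in\mathcal S_0$, an $[R,l]$ code consists of a message set $\mathcal U=\{1,\ldots,2^{lR}\}$, an encoder mapping each $u\in\mathcal U$ to a codeword $(\mathbf x_{(u)}[0],\ldots,\mathbf x_{(u)}[l-1])$, and a decoder $d_l$ mapping the $l$ outputs to a message; neither depends on $\mathbf S_0$. With the message $U$ uniform on $\mathcal U$, the codewords must satisfy the power constraint. The error probability is $P_e^l(\mathbf s_0)=2^{-lR}\sum_{u}\Pr(d_l(\mathbf Y^{l-1})\ne u\mid U=u,\mathbf S_0=\mathbf s_0)$. A rate $R_c$ is achievable if for every $\epsilon_1,\epsilon_2>0$ there is $l_0>0$ such that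 for all integers $l>l_0$ there is an $[R,l]$ code with $\sup_{\mathbf s_0\in\mathcal S_0}P_e^l(\mathbf s_0)<\epsilon_1$ and $R\ge R_c-\epsilon_2$. Capacity is the supremum of achievable rates. *)

(* Defs.v *)
From HB Require Import structures.
From mathcomp Require Import all_boot all_order all_algebra.
From mathcomp Require Import all_classical all_reals all_analysis.
From mathcomp Require Import ess_sup_inf.

Set Implicit Arguments.
Unset Strict Implicit.
Unset Printing Implicit Defensive.

Import Order.TTheory GRing.Theory Num.Theory.
Import numFieldNormedType.Exports.

Local Open Scope classical_set_scope.
Local Open Scope ring_scope.

(* The product (= Borel) sigma-algebra on real matrices: the one generated by
   the entries, in the style of the library's instance on tuples. *)
Section measurable_matrix.
Context (R : realType) (m n : nat).

Let entry : 'I_(m * n) -> 'M[R]_(m, n) -> R := fun k A => mxvec A 0 k.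

Let matrix_set0 : g_sigma_preimage entry set0.
Proof. exact: sigma_algebra0. Qed.

Let matrix_setC A : g_sigma_preimage entry A -> g_sigma_preimage entry (~` A).
Proof. exact: sigma_algebraC. Qed.

Let matrix_bigcup (F : (set 'M[R]_(m, n))^nat) :
  (forall i, g_sigma_preimage entry (F i)) ->
  g_sigma_preimage entry (\bigcup_i (F i)).
Proof. exact: sigma_algebra_bigcup. Qed.

HB.instance Definition _ := @isMeasurable.Build default_measure_display
  'M[R]_(m, n) (g_sigma_preimage entry) matrix_set0 matrix_setC matrix_bigcup.

End measurable_matrix.

(* A finite block of vectors y[t_0], ..., y[t_(k-1)] in R^n is stored as the
   n x k matrix whose j-th column is y[t_j]. *)
Definition samples (R : realType) (T : Type) (n k : nat)
    (W : int -> T -> 'cV[R]_n) (t : 'I_k -> int) (w : T) : 'M[R]_(n, k) :=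
  \matrix_(i, j) W (t j) w i 0.

(* The block y[a], ..., y[a + k - 1]. *)
Definition window (R : realType) (T : Type) (n : nat)
    (W : int -> T -> 'cV[R]_n) (a : int) (k : nat) : T -> 'M[R]_(n, k) :=
  samples W (fun j : 'I_k => a + (j : nat)%:Z).

Section noise.
Context d (T : measurableType d) (R : realType) (P : probability T R) (n : nat).
Variable W : int -> T -> 'cV[R]_n.

Definition random_process := forall i, measurable_fun [set: T] (W i).

Definition zero_mean := forall i (j : 'I_n),
  P.-integrable [set: T] (fun w => (W i w j 0)%:E) /\
  ('E_P[fun w => W i w j ord0] = 0)%E.

(* Invariance of all finite-dimensional joint laws, whether or not they have
   densities. *)
Definition cyclostationary (p : nat) :=
  forall (k : nat) (t : 'I_k -> int) (A : set 'M[R]_(n, k)), measurable A ->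
    P (samples W (fun j => t j + p%:Z) @^-1` A) = P (samples W t @^-1` A).

(* The blocks are W[i1], ..., W[i1 + l1] and W[i2], ..., W[i2 + l2]. *)
Definition finitely_dependent (m : nat) :=
  forall (i1 i2 : int) (l1 l2 : nat), i1 + l1%:Z + m%:Z < i2 ->
  forall (A : set 'M[R]_(n, l1.+1)) (B : set 'M[R]_(n, l2.+1)),
    measurable A -> measurable B ->
    P (window W i1 l1.+1 @^-1` A `&` window W i2 l2.+1 @^-1` B) =
    (P (window W i1 l1.+1 @^-1` A) * P (window W i2 l2.+1 @^-1` B))%E.

(* Scalar coefficients and finite combinations, up to null sets: the weakest
   reading of the condition. *)
Definition linearly_irredundant := forall i0 : int,
  ~ exists (s : seq int) (c : int -> R), i0 \notin s /\
      {ae P, forall w, W i0 w = \sum_(i <- s) c i *: W i w}.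

End noise.

Section conditional_probability.
Context d d' (T : measurableType d) (S : measurableType d') (R : realType).
Variables (P : probability T R) (V : T -> S) (E : set T).

Definition is_cond_prob (g : S -> R) :=
  [/\ measurable_fun [set: S] g, forall s, 0 <= g s &
      forall B, measurable B ->
        P (E `&` V @^-1` B) = (\int[P]_(w in V @^-1` B) (g (V w))%:E)%E].

(* A version of s |-> Pr(E | V = s), unique up to a null set of the law of V. *)
Definition cond_prob : S -> R := xget (cst 0) is_cond_prob.

End conditional_probability.

(* Y[i] = \sum_(tau <= memory) gain i tau *m X[i - tau] + noise i. *)
Record channel (T : Type) (R : realType) (nt nr : nat) := Channel {
  memory : nat;
  gain : int -> nat -> 'M[R]_(nr, nt);
  noise : int -> T -> 'cV[R]_nr }.

Definition column (R : realType) (n k : nat) (A : 'M[R]_(n, k)) (j : nat) :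
    'cV[R]_n :=
  if insub j is Some j' then col j' A else 0.

(* The outputs Y[0], ..., Y[l - 1].  The columns of row_mx x0 x are
   X[-memory], ..., X[l - 1], so that X[i] is its column number memory + i. *)
Definition output (T : Type) (R : realType) (nt nr : nat)
    (ch : channel T R nt nr) (l : nat) (x0 : 'M[R]_(nt, memory ch))
    (x : 'M[R]_(nt, l)) (w : T) : 'M[R]_(nr, l) :=
  \matrix_(a, i) (\sum_(tau < (memory ch).+1)
      gain ch (i : nat)%:Z tau *m column (row_mx x0 x) (memory ch + i - tau)
    + noise ch (i : nat)%:Z w) a 0.

(* An [rate, l] code for the power budget Pow.  The power constraint is an
   average over a uniformly distributed message. *)
Record code (R : realType) (nt nr : nat) (Pow rate : R) (l : nat) := Code {
  messages : nat;
  encoder : 'I_messages -> 'M[R]_(nt, l);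
  decoder : 'M[R]_(nr, l) -> 'I_messages;
  code_rate : messages%:R = 2 `^ (l%:R * rate);
  decoder_measurable : forall u, measurable (decoder @^-1` [set u]);
  code_power : l%:R^-1 * \sum_(i < l) (messages%:R^-1 *
      \sum_(u < messages) \sum_(a < nt) encoder u a i ^+ 2) <= Pow }.
Arguments encoder {R nt nr Pow rate l} c u.
Arguments decoder {R nt nr Pow rate l} c y.

Section capacity.
Context d (T : measurableType d) (R : realType) (P : probability T R).
Context (nt nr : nat) (ch : channel T R nt nr) (Pow : R).

Definition noise_state : T -> 'M[R]_(nr, memory ch) :=
  window (noise ch) (- (memory ch)%:Z) (memory ch).

(* The error probability given the initial state (x0, s).  The noise is
   independent of the message, and the initial inputs are a parameter: given
   the message u and x0, the only randomness left is that of the noise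
   conditioned on its own initial block being s. *)
Definition error_prob rate l (c : code nt nr Pow rate l)
    (x0 : 'M[R]_(nt, memory ch)) (s : 'M[R]_(nr, memory ch)) : R :=
  (messages c)%:R^-1 * \sum_(u < messages c)
    cond_prob P noise_state
      [set w | decoder c (output x0 (encoder c u) w) <> u] s.

(* The supremum over the initial states; conditional probabilities being
   defined up to null sets, it is essential in the noise component. *)
Definition worst_error rate l (c : code nt nr Pow rate l) : \bar R :=
  ereal_sup [set ess_sup P (fun w => (error_prob c x0 (noise_state w))%:E)
            | x0 in [set: 'M[R]_(nt, memory ch)]].

Definition achievable (Rc : R) :=
  forall e1 e2 : R, 0 < e1 -> 0 < e2 ->
  exists2 l0 : nat, (0 < l0)%N & forall l : nat, (l0 < l)%N ->
    exists (rate : R) (c : code nt nr Pow rate l),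
      (worst_error c < e1%:E)%E /\ Rc - e2 <= rate.

Definition capacity : \bar R := ereal_sup (EFin @` achievable).

End capacity.

(* The blocks of p consecutive vectors of the original channel; the dimensions
   \sum_(a < p) nr = p * nr and \sum_(b < p) nt = p * nt are in the form that
   block matrices require. *)
Section DCD.
Context (T : Type) (R : realType) (nt nr m p : nat).
Variables (G : int -> nat -> 'M[R]_(nr, nt)) (W : int -> T -> 'cV[R]_nr).

Definition DCD_gain0 : 'M[R]_(\sum_(a < p) nr, \sum_(b < p) nt) :=
  \mxblock_(a < p, b < p)
    (if (b <= a)%N && (a - b <= m)%N then G (a : nat)%:Z (a - b)%N else 0).

Definition DCD_gain1 : 'M[R]_(\sum_(a < p) nr, \sum_(b < p) nt) :=
  \mxblock_(a < p, b < p)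
    (if (1 <= p + a - b <= m)%N then G (a : nat)%:Z (p + a - b)%N else 0).

Definition DCD_noise (i : int) (w : T) : 'cV[R]_(\sum_(a < p) nr) :=
  \mxcol_(a < p) W (i * p%:Z + (a : nat)%:Z) w.

Definition DCD : channel T R (\sum_(b < p) nt) (\sum_(a < p) nr) :=
  Channel 1 (fun _ tau => if tau == 0%N then DCD_gain0 else DCD_gain1)
    DCD_noise.

End DCD.

(* Main.v *)
(* Both channels are reduced to one figure of merit of a code: its error
   probability when the past inputs are zero and the noise is not conditioned on
   its past.  This mean error is at most the worst error over the initial states.
   Conversely, let the encoder send g zeros first and the decoder ignore the
   first g outputs.  If g is at least the memory, the outputs that are kept do
   not depend on the past inputs; by finite dependence their noise is independent
   of the noise in the initial state; and if g is a period, the code faces the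
   original channel.  So the worst error of the guarded code is at most the mean
   error of the original code, at a cost in rate that vanishes with the length.
   Started from zero inputs, the two channels are the same up to cutting
   sequences into blocks of length p, which preserves the mean error, multiplies
   the rate by p and turns the power budget Pow into p * Pow.
   The guard is needed in one direction: as a finitely dependent process need not
   be Markov, conditioning on W[-p], ..., W[-1] (the state of the block channel)
   may carry more information than conditioning on W[-m], ..., W[-1]. *)

From HB Require Import structures.
From mathcomp Require Import all_boot all_order all_algebra.
From mathcomp Require Import all_classical all_reals all_analysis.
From mathcomp Require Import ess_sup_inf measurable_realfun.
From mathcomp Require Import zify lra.
Require Import Defs.

Set Implicit Arguments.
Unset Strict Implicit.
Unset Printing Implicit Defensive.

Import Order.TTheory GRing.Theory Num.Theory.
Import numFieldNormedType.Exports.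
Local Open Scope classical_set_scope.
Local Open Scope ring_scope.

(** * Measurability of matrix-valued maps, and image measures *)

Lemma measurable_mx_entry (R : realType) (m n : nat) (i : 'I_m) (j : 'I_n) :
  measurable_fun [set: 'M[R]_(m, n)] (fun A : 'M[R]_(m, n) => A i j).
Proof.
move=> _ Y mY; rewrite setTI; apply: sub_sigma_algebra => /=.
rewrite -bigcup_seq/=; exists (mxvec_index i j).
  by rewrite /= mem_index_enum.
by exists Y => //; rewrite setTI; apply/seteqP; split => A /=; rewrite mxvecE.
Qed.

Lemma measurable_fun_mxP d (T : measurableType d) (R : realType) (m n : nat)
    (f : T -> 'M[R]_(m, n)) :
  measurable_fun [set: T] f <->
  forall i j, measurable_fun [set: T] (fun x => f x i j).
Proof.
split=> [mf i j|mf].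
  exact: (measurableT_comp (@measurable_mx_entry R m n i j) mf).
apply: (@measurability _ _ _ _ _ _ (\big[setU/set0]_(k < m * n)
  preimage_set_system [set: 'M[R]_(m, n)]
    (fun A : 'M[R]_(m, n) => mxvec A 0 k) measurable)) => //.
move=> _ [A + <-]; rewrite -bigcup_seq /= => -[k _ [B mB <-]].
case/mxvec_indexP: k => i j.
have := mf i j measurableT B mB; congr (measurable _).
by apply/seteqP; split => x /= [_ h]; (split; first by []);
  move: h; rewrite ?setTI /= mxvecE // => -[].
Qed.

(** The law of [f], bundled as a finite measure: the form that Radon-Nikodym and the
    almost-everywhere comparison of integrals require. *)
Lemma pushforward_finite_measure d d' (T : measurableType d)
    (S : measurableType d') (R : realType)
    (m : {finite_measure set T -> \bar R}) (f : T -> S) :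
  measurable_fun [set: T] f ->
  exists mu : {finite_measure set S -> \bar R},
    (forall A, mu A = m (f @^-1` A)) /\
    (forall D (g : S -> \bar R), measurable D -> measurable_fun [set: S] g ->
       (forall y, 0 <= g y)%E ->
       (\int[mu]_(y in D) g y = \int[m]_(x in f @^-1` D) g (f x))%E).
Proof.
move=> mf.
have mu0 : pushforward m f set0 = 0%E by exact: measure0.
have mu_ge0 A : (0 <= pushforward m f A)%E by exact: measure_ge0.
have mu_add : semi_sigma_additive (pushforward m f).
  exact: measure_semi_sigma_additive.
have mu_fin : fin_num_fun (pushforward m f).
  move=> A mA; apply: fin_num_measure.
  by rewrite -[X in measurable X]setTI; exact: mf.
have int_mu D (g : S -> \bar R) : measurable D -> measurable_fun [set: S] g ->
    (forall y, 0 <= g y)%E ->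
    (\int[pushforward m f]_(y in D) g y = \int[m]_(x in f @^-1` D) g (f x))%E.
  move=> mD mg g_ge0; rewrite ge0_integral_pushforward//.
  exact: measurable_funTS.
have muE A : pushforward m f A = m (f @^-1` A) by [].
(* Once the set function is a variable, the structures are packed from exactly the facts proved
   above. *)
move: (pushforward m f) int_mu muE mu0 mu_ge0 mu_add mu_fin.
move=> mu int_mu muE mu0 mu_ge0 mu_add mu_fin.
pose M := isMeasure.Build _ _ _ mu mu0 mu_ge0 mu_add.
pose mu1 : {measure set S -> \bar R} := HB.pack mu M.
pose F := Measure_isFinite.Build _ _ _ mu1 mu_fin.
by exists (HB.pack_for {finite_measure set S -> \bar R} mu M F).
Qed.

(** * Conditional probability given a random variable *)

Section conditioning.
Context d d' (T : measurableType d) (S : measurableType d') (R : realType).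
Variables (P : probability T R) (V : T -> S).
Hypothesis mV : measurable_fun [set: T] V.

Let measurable_preimage B : measurable B -> measurable (V @^-1` B).
Proof. by move=> mB; rewrite -[X in measurable X]setTI; exact: mV. Qed.

(** A version exists by Radon-Nikodym: it is the density of the law of [V] under [P] restricted to
    [E] with respect to the law of [V] under [P]. *)
Lemma cond_probP (E : set T) : measurable E ->
  is_cond_prob P V E (cond_prob P V E).
Proof.
move=> mE; suff [g gP] : exists g, is_cond_prob P V E g by exact: (xgetI _ gP).
have [mu [muE int_mu]] := pushforward_finite_measure P mV.
have [nu [nuE _]] := pushforward_finite_measure (mrestr P mE) mV.
have nu_mu : nu `<< mu.
  apply/null_content_dominatesP => A mA muA0.
  have PA0 : P (V @^-1` A) = 0%E by rewrite -muE.
  suff: P (V @^-1` A `&` E) = 0%E by exact: etrans (nuE A).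
  apply/eqP; rewrite eq_le measure_ge0 andbT -PA0 le_measure ?inE//.
    by apply: measurableI => //; exact: measurable_preimage.
  exact: measurable_preimage.
have [f [f_ge0 f_fin f_int fE]] := radon_nikodym_sigma_finite nu_mu.
have mf : measurable_fun [set: S] f by exact: measurable_int f_int.
exists (fine \o f); split.
- exact: measurableT_comp.
- by move=> s; exact: fine_ge0.
move=> B mB; rewrite setIC; apply: etrans (esym (nuE B)) _.
apply: etrans (fE B mB) _; apply: etrans (int_mu B f mB mf f_ge0) _.
by apply: eq_integral => w _ /=; rewrite fineK.
Qed.

Lemma integral_cond_prob (E : set T) : measurable E ->
  (\int[P]_w (cond_prob P V E (V w))%:E = P E)%E.
Proof.
move=> mE; have [_ _ /(_ setT measurableT)] := cond_probP mE.
by rewrite preimage_setT setIT => ->.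
Qed.

(** Under independence the constant [P E] and the conditional probability have equal integrals over
    every measurable set for the law of [V], hence agree outside a null set of that law. *)
Lemma cond_prob_independent (E : set T) : measurable E ->
    (forall B, measurable B -> P (E `&` V @^-1` B) = (P E * P (V @^-1` B))%E) ->
  {ae P, forall w, cond_prob P V E (V w) = fine (P E)}.
Proof.
move=> mE indep; have [mg g_ge0 gE] := cond_probP mE.
set g := cond_prob P V E in mg g_ge0 gE *.
have [mu [muE int_mu]] := pushforward_finite_measure P mV.
have mg' : measurable_fun [set: S] (EFin \o g) by exact/measurable_EFinP.
have int_g B : measurable B ->
    (\int[mu]_(s in B) (g s)%:E = P (E `&` V @^-1` B))%E.
  move=> mB; rewrite gE//; apply: (int_mu B _ mB mg') => s.
  by rewrite lee_fin.
have PE : (fine (P E))%:E = P E by rewrite fineK// fin_num_measure.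
have : ae_eq mu setT (EFin \o g) (cst (fine (P E))%:E).
  apply: integral_ae_eq => //.
    apply/integrableP; split => //.
    under eq_integral do rewrite gee0_abs ?lee_fin//.
    by rewrite int_g// preimage_setT setIT -PE ltry.
  move=> B _ mB; apply: etrans (int_g B mB) _.
  by rewrite indep// integral_cst// PE; congr (_ * _)%E; exact: esym (muE B).
(* A null set of the law of [V] pulls back to a null set of [P]. *)
case=> N [mN N0 gN]; exists (V @^-1` N); split.
- exact: measurable_preimage.
- exact: etrans (esym (muE N)) N0.
- by move=> w /= gw; apply: gN => /= /(_ Logic.I) [].
Qed.

End conditioning.

(** * Noise windows and channel outputs *)

Lemma measurable_window d (T : measurableType d) (R : realType) (n : nat)
    (W : int -> T -> 'cV[R]_n) (a : int) (k : nat) :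
  random_process W -> measurable_fun [set: T] (window W a k).
Proof.
move=> mW; apply/measurable_fun_mxP => i j.
rewrite (_ : (fun _ => _) = (fun w => W (a + (j : nat)%:Z) w i 0)).
  by have /measurable_fun_mxP := mW (a + (j : nat)%:Z); exact.
by apply/funext => w; rewrite mxE.
Qed.

Section channel_output.
Context d (T : measurableType d) (R : realType) (nt nr : nat).
Variable ch : channel T R nt nr.

Definition signal (l : nat) (x : 'M[R]_(nt, l)) : 'M[R]_(nr, l) :=
  \matrix_(a, i) (\sum_(tau < (memory ch).+1)
    gain ch (i : nat)%:Z tau *m
      column (row_mx (0 : 'M[R]_(nt, memory ch)) x) (memory ch + i - tau)) a 0.

Lemma output_from_rest (l : nat) (x : 'M[R]_(nt, l)) (w : T) :
  output (0 : 'M[R]_(nt, memory ch)) x w = signal x + window (noise ch) 0 l w.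
Proof. by apply/matrixP => a i; rewrite !mxE add0r. Qed.

Lemma measurable_output (l : nat) (x0 : 'M[R]_(nt, memory ch))
    (x : 'M[R]_(nt, l)) :
  random_process (noise ch) -> measurable_fun [set: T] (output x0 x).
Proof.
move=> mW; apply/measurable_fun_mxP => a i.
under eq_fun do rewrite !mxE.
apply: measurable_funD => //.
by have /measurable_fun_mxP := mW (i : nat)%:Z; exact.
Qed.

End channel_output.

(** * The mean error and its comparison with the worst error *)

Section mean_error.
Context d (T : measurableType d) (R : realType) (P : probability T R).
Context (nt nr : nat) (ch : channel T R nt nr) (Pow rate : R) (l : nat).
Variable c : code nt nr Pow rate l.

Definition error_event (x0 : 'M[R]_(nt, memory ch)) (u : 'I_(messages c)) :
    set T :=
  [set w | decoder c (output x0 (encoder c u) w) <> u].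

Definition mean_error : R :=
  (messages c)%:R^-1 * \sum_(u < messages c) fine (P (error_event 0 u)).

Hypothesis mW : random_process (noise ch).

Lemma measurable_error_event x0 u : measurable (error_event x0 u).
Proof.
rewrite (_ : error_event x0 u =
  ~` (output x0 (encoder c u) @^-1` (decoder c @^-1` [set u]))) //.
apply: measurableC; rewrite -[X in measurable X]setTI.
exact: measurable_output (decoder_measurable u).
Qed.

(** By total probability the mean error is the integral of the conditional error for zero past
    inputs, and an integral over a probability space is at most the essential supremum. *)
Lemma mean_error_le_worst : (mean_error%:E <= worst_error P ch c)%E.
Proof.
apply: (@le_trans _ _
  (ess_sup P (fun w => (error_prob P c 0 (noise_state ch w))%:E))); last first.
  by apply: ereal_sup_ubound; exists 0.
set V := noise_state ch; set f := fun w => _.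
have mV : measurable_fun [set: T] V by exact: measurable_window.
pose g u := cond_prob P V (error_event 0 u).
have gP u : is_cond_prob P V (error_event 0 u) (g u).
  exact: cond_probP (measurable_error_event 0 u).
have fE w : f w =
    ((messages c)%:R^-1%:E * \sum_(u < messages c) (g u (V w))%:E)%E.
  by rewrite sumEFin -EFinM.
have mg u : measurable_fun [set: T] (fun w => (g u (V w))%:E).
  by apply/measurable_EFinP; apply: measurableT_comp => //; have [] := gP u.
have g_ge0 u w : (0 <= (g u (V w))%:E)%E.
  by rewrite lee_fin; have [_ + _] := gP u; exact.
have mf : measurable_fun [set: T] f.
  rewrite (funext fE); apply: emeasurable_funM => //.
  exact: emeasurable_sum.
have f_ge0 w : (0 <= f w)%E.
  by rewrite fE mule_ge0 ?lee_fin ?invr_ge0// sume_ge0.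
have -> : mean_error%:E = (\int[P]_w f w)%E.
  under eq_integral do rewrite fE.
  rewrite ge0_integralZl_EFin ?invr_ge0//; last 2 first.
  - by move=> w _; rewrite sume_ge0.
  - exact: emeasurable_sum.
  rewrite ge0_integral_sum// EFinM -sumEFin; congr (_ * _)%E.
  apply: eq_bigr => u _; rewrite integral_cond_prob//.
    by rewrite fineK// fin_num_measure//; exact: measurable_error_event.
  exact: measurable_error_event.
have P1 : (0 < P [set: T])%E by rewrite probability_setT.
have e_ge0 : (0 <= ess_sup P f)%E.
  by apply: ess_sup_gee => //; exact: nearW.
(* The total mass is 1, so the bound can be written as the integral of a constant. *)
have -> : ess_sup P f = (\int[P]_(w in setT) cst (ess_sup P f) w)%E.
  rewrite integral_cst// -[LHS]mule1; congr (_ * _)%E.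
  exact: esym (probability_setT P).
apply: ae_ge0_le_integral => //.
by apply: filterS (ess_sup_ge P f) => w + _.
Qed.

End mean_error.

(** * Columns of concatenated matrices *)

Section columns.
Context (R : realType) (n k : nat).
Implicit Type A : 'M[R]_(n, k).

Lemma column_ord A (j : 'I_k) : column A j = col j A.
Proof. by rewrite /column valK. Qed.

Lemma column_geq A j : (k <= j)%N -> column A j = 0.
Proof. by move=> kj; rewrite /column insubF// ltnNge kj. Qed.

Lemma column0 j : column (0 : 'M[R]_(n, k)) j = 0.
Proof.
rewrite /column; case: insubP => // i _ _.
by apply/matrixP => a b; rewrite !mxE.
Qed.

End columns.

Section column_row_mx.
Context (R : realType) (n k m : nat) (A : 'M[R]_(n, k)) (B : 'M[R]_(n, m)).

Lemma column_row_mxl j :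
  (j < k)%N -> column (row_mx A B) j = column A j.
Proof.
(* The ascription states the rewrite rule for [j] itself, to which the value of the ordinal is
   convertible. *)
move=> jk; rewrite (column_ord (row_mx A B) (lshift m (Ordinal jk)) :
  column (row_mx A B) j = _).
rewrite (column_ord A (Ordinal jk) : column A j = _).
by apply/matrixP => a b; rewrite mxE row_mxEl mxE.
Qed.

Lemma column_row_mxr j :
  column (row_mx A B) (k + j) = column B j.
Proof.
have [jm|mj] := ltnP j m; last by rewrite !column_geq// leq_add2l.
rewrite (column_ord (row_mx A B) (rshift k (Ordinal jm)) :
  column (row_mx A B) (k + j) = _).
rewrite (column_ord B (Ordinal jm) : column B j = _).
by apply/matrixP => a b; rewrite mxE row_mxEr mxE.
Qed.

End column_row_mx.

(** * Guarding a code against the initial state *)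

Section guard.
Context d (T : measurableType d) (R : realType) (P : probability T R).
Context (nt nr : nat) (ch : channel T R nt nr).

(* After g idle uses the channel has forgotten its initial state and is back in
   phase with its period. *)
Definition renewable (g : nat) :=
  [/\ random_process (noise ch),
      (memory ch <= g)%N /\
      (forall (i tau : nat), (tau <= memory ch)%N ->
         gain ch (g + i)%:Z tau = gain ch i%:Z tau),
      forall l (B : set 'M[R]_(nr, l)), measurable B ->
        P (window (noise ch) g%:Z l @^-1` B) =
        P (window (noise ch) 0 l @^-1` B) &
      forall l (A : set 'M[R]_(nr, memory ch)) (B : set 'M[R]_(nr, l)),
        measurable A -> measurable B ->
        P (window (noise ch) g%:Z l @^-1` B `&` noise_state ch @^-1` A) =
        (P (window (noise ch) g%:Z l @^-1` B) * P (noise_state ch @^-1` A))%E].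

Variables (g l r : nat).
Hypothesis ren : renewable g.

(** The [g] leading zeros are the guard; the [r] trailing ones fill up lengths that are not a whole
    number of blocks. *)
Definition guarded (x : 'M[R]_(nt, l)) : 'M[R]_(nt, g + l + r) :=
  row_mx (row_mx 0 x) 0.

Definition unguard (y : 'M[R]_(nr, g + l + r)) : 'M[R]_(nr, l) :=
  rsubmx (lsubmx y).

Lemma measurable_unguard : measurable_fun [set: 'M[R]_(nr, g + l + r)] unguard.
Proof.
apply/measurable_fun_mxP => a i.
rewrite (_ : (fun _ => _) =
  (fun y : 'M[R]_(nr, g + l + r) => y a (lshift r (rshift g i)))).
  exact: measurable_mx_entry.
by apply/funext => y; rewrite !mxE.
Qed.

(** As [memory ch <= g], the kept outputs reach back into the guard at most, never into [x0]; the
    gains they meet are those of a start at time 0. *)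
Lemma unguard_output (x0 : 'M[R]_(nt, memory ch)) (x : 'M[R]_(nt, l)) w :
  unguard (output x0 (guarded x) w) =
  signal ch x + window (noise ch) g%:Z l w.
Proof.
have [_ [mem_g gainE] _ _] := ren.
apply/matrixP => a i; rewrite !mxE; congr (_ + _).
congr (fun_of_matrix _ a 0); apply: eq_bigr => tau _.
have tau_mem : (tau <= memory ch)%N by rewrite -ltnS.
rewrite /= gainE//; congr (_ *m _).
rewrite -addnBA; last first.
  by rewrite (leq_trans tau_mem)// (leq_trans mem_g)// leq_addr.
rewrite column_row_mxr.
have -> : column (guarded x) (g + i - tau) =
    column (row_mx (0 : 'M[R]_(nt, g)) x) (g + i - tau).
  by apply: column_row_mxl; have := ltn_ord i; lia.
(* For [i < tau] the left side reads a guard zero and the right side a zero initial input. *)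
have [i_tau|tau_i] := ltnP i tau.
  rewrite !column_row_mxl ?column0//; first by lia.
  by lia.
by rewrite -!addnBA// !column_row_mxr.
Qed.

Lemma guarded_power (x : 'M[R]_(nt, l)) (F : R -> R) : F 0 = 0 ->
  \sum_(i < g + l + r) \sum_(a < nt) F (guarded x a i) =
  \sum_(i < l) \sum_(a < nt) F (x a i).
Proof.
move=> F0; rewrite !big_split_ord /=.
rewrite big1 ?add0r => [|i _]; last first.
  by apply: big1 => a _; rewrite !row_mxEl mxE.
rewrite [X in _ + X]big1 ?addr0 => [|i _]; last first.
  by apply: big1 => a _; rewrite row_mxEr mxE.
by apply: eq_bigr => i _; apply: eq_bigr => a _; rewrite row_mxEl row_mxEr.
Qed.

(** The message set is kept, so its bits are spread over more uses; the zeros add no energy and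
    lengthen the average. Whatever [x0], the error depends only on noise from time [g] on, which is
    independent of [noise_state], so its conditional probability is almost surely constant. *)
Lemma guard_code (Pow rate : R) (c : code nt nr Pow rate l) : (0 < l)%N ->
  exists c' : code nt nr Pow (l%:R * rate / (g + l + r)%:R) (g + l + r),
    (worst_error P ch c' <= (mean_error P ch c)%:E)%E.
Proof.
move=> l_gt0; have n_gt0 : (0 < g + l + r)%N by lia.
have rate' : (messages c)%:R =
    2 `^ ((g + l + r)%:R * (l%:R * rate / (g + l + r)%:R)) :> R.
  by rewrite mulrC divfK ?pnatr_eq0 -?lt0n// code_rate.
have dec' u : measurable ((decoder c \o unguard) @^-1` [set u]).
  rewrite comp_preimage -[X in measurable X]setTI.
  exact: measurable_unguard (decoder_measurable u).
have pow' : (g + l + r)%:R^-1 * \sum_(i < g + l + r) ((messages c)%:R^-1 *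
    \sum_(u < messages c) \sum_(a < nt) guarded (encoder c u) a i ^+ 2) <= Pow.
  apply: le_trans (code_power c).
  rewrite -!mulr_sumr exchange_big [X in _ <= _ * (_ * X)]exchange_big /=.
  under eq_bigr do rewrite (guarded_power _ (F := fun y => y ^+ 2)) ?expr0n//.
  apply: ler_wpM2r.
    rewrite mulr_ge0 ?invr_ge0 ?ler0n//.
    by do 3!apply: sumr_ge0 => ? _; exact: sqr_ge0.
  by rewrite lef_pV2 ?posrE ?ltr0n// ler_nat; lia.
have [mW _ renewal indep] := ren.
have m_window : measurable_fun [set: T] (window (noise ch) g%:Z l).
  exact: measurable_window.
exists (Code (encoder := fun u => guarded (encoder c u)) rate' dec' pow').
apply: ub_ereal_sup => _ [x0 _ <-]; apply/ess_supP.
pose A u : set 'M[R]_(nr, l) :=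
  [set N | decoder c (signal ch (encoder c u) + N) <> u].
have mA u : measurable (A u).
  rewrite (_ : A u = ~` ((fun N => signal ch (encoder c u) + N) @^-1`
    (decoder c @^-1` [set u])))//.
  apply: measurableC; rewrite -[X in measurable X]setTI.
  apply: (_ : measurable_fun setT (fun N => signal ch (encoder c u) + N)) => //.
    apply/measurable_fun_mxP => a i; under eq_fun do rewrite mxE.
    by apply: measurable_funD => //; exact: measurable_mx_entry.
  exact: decoder_measurable.
have eventE u : error_event (0 : 'M[R]_(nt, memory ch)) u =
    window (noise ch) 0 l @^-1` A u.
  by apply/seteqP; split => w /=; rewrite /error_event /= output_from_rest.
have event'E u :
    [set w | decoder c (unguard (output x0 (guarded (encoder c u)) w)) <> u] =
    window (noise ch) g%:Z l @^-1` A u.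
  by apply/seteqP; split => w /=; rewrite unguard_output.
have ae_u u : {ae P, forall w, cond_prob P (noise_state ch)
    (window (noise ch) g%:Z l @^-1` A u) (noise_state ch w) =
    fine (P (error_event (0 : 'M[R]_(nt, memory ch)) u))}.
  rewrite eventE -renewal//; apply: cond_prob_independent.
  - exact: measurable_window.
  - by rewrite -[X in measurable X]setTI; exact: m_window.
  - by move=> B mB; exact: indep.
(* There are finitely many messages, so one null set serves them all. *)
have /= ae_all : {ae P, forall w, forall u : 'I_(messages c),
    cond_prob P (noise_state ch) (window (noise ch) g%:Z l @^-1` A u)
      (noise_state ch w) =
    fine (P (error_event (0 : 'M[R]_(nt, memory ch)) u))}.
  exact: filter_forall.
apply: filterS ae_all => w all_u; rewrite lee_fin /error_prob /mean_error /=.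
by under eq_bigr do rewrite event'E all_u.
Qed.

End guard.

(** * Cutting sequences into blocks of length [p] *)

Lemma sum_wrap (V : nmodType) (p m : nat) (a : 'I_p) (H : nat -> V) :
  (m < p)%N ->
  \sum_(b < p) (if (b <= a)%N && (a - b <= m)%N then H (a - b)%N else 0) +
  \sum_(b < p) (if (1 <= p + a - b <= m)%N then H (p + a - b)%N else 0) =
  \sum_(tau < m.+1) H tau.
Proof.
move=> mp; rewrite (big_ord_widen _ H mp) [RHS]big_mkcond -big_split /=.
(* The lag [(a - b) mod p] takes each value below [p] once as [b] varies. Since [m < p], a position
   [b <= a] contributes only to the first sum and any other only to the second. *)
have tauP (b : 'I_p) : ((if b <= a then a - b else p + a - b) < p)%N.
  by have := ltn_ord a; have := ltn_ord b; case: (leqP b a); lia.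
rewrite [RHS](reindex_inj (h := fun b => Ordinal (tauP b))) /=; last first.
  move=> b b' /(congr1 val) /=; have := ltn_ord b; have := ltn_ord b'.
  move=> ? ? e; apply/val_inj; move: e => /=.
  by case: (leqP b a); case: (leqP b' a); lia.
apply: eq_bigr => b _; have := ltn_ord b; have := ltn_ord a => ap bp.
case: (leqP b a) => /= ba; rewrite ltnS.
  by rewrite [X in _ + X]ifF ?addr0//; lia.
by rewrite add0r; case: ifP; case: ifP => //; lia.
Qed.

Section blocks.
Context (R : realType) (l p : nat).
Lemma slot_subproof (i : 'I_l) (a : 'I_p) : (i * p + a < l * p)%N.
Proof. by have := ltn_ord a; have := ltn_ord i; nia. Qed.

Definition slot (i : 'I_l) (a : 'I_p) : 'I_(l * p) :=
  Ordinal (slot_subproof i a).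

Hypothesis p_gt0 : (0 < p)%N.

Lemma slot_block_subproof (j : 'I_(l * p)) : (j %/ p < l)%N.
Proof. by rewrite ltn_divLR. Qed.

Definition slot_block (j : 'I_(l * p)) : 'I_l :=
  Ordinal (slot_block_subproof j).

Definition slot_offset (j : 'I_(l * p)) : 'I_p := Ordinal (ltn_pmod j p_gt0).

Lemma slot_blockK i a : slot_block (slot i a) = i.
Proof. by apply/val_inj; rewrite /= divnMDl// divn_small ?addn0. Qed.

Lemma slot_offsetK i a : slot_offset (slot i a) = a.
Proof. by apply/val_inj; rewrite /= modnMDl modn_small. Qed.

Lemma slotK j : slot (slot_block j) (slot_offset j) = j.
Proof. by apply/val_inj; rewrite /= -divn_eq. Qed.

Lemma sum_slots (V : nmodType) (F : 'I_(l * p) -> V) :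
  \sum_j F j = \sum_(i < l) \sum_(a < p) F (slot i a).
Proof.
rewrite pair_bigA (reindex (fun ia : 'I_l * 'I_p => slot ia.1 ia.2)) //.
exists (fun j => (slot_block j, slot_offset j)) => [[i a]|j] _ /=.
  by rewrite slot_blockK slot_offsetK.
exact: slotK.
Qed.

Context (n : nat).

(** [tagnat] splits a stacked index into an offset in the block and a coordinate; [\mxcol] and
    [\mxblock] use the same indexing. *)
Definition blocks (A : 'M[R]_(n, l * p)) : 'M[R]_(\sum_(a < p) n, l) :=
  \matrix_(k, i) A (tagnat.sig2 k) (slot i (tagnat.sig1 k)).

Definition unblocks (B : 'M[R]_(\sum_(a < p) n, l)) : 'M[R]_(n, l * p) :=
  \matrix_(c, j) B (@tagnat.Rank p (fun=> n) (slot_offset j) c) (slot_block j).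

Lemma blocksK : cancel blocks unblocks.
Proof.
move=> A; apply/matrixP => c j; rewrite !mxE.
rewrite (_ : tagnat.sig2 _ = c); last by apply/val_inj; rewrite tagnat.Rank2K.
by rewrite tagnat.Rank1K slotK.
Qed.

Lemma unblocksK : cancel unblocks blocks.
Proof.
move=> B; apply/matrixP => k i; rewrite !mxE slot_blockK slot_offsetK.
by rewrite tagnat.sig2K.
Qed.

Lemma blocksD A B : blocks (A + B) = blocks A + blocks B.
Proof. by apply/matrixP => k i; rewrite !mxE. Qed.

Lemma sum_blocks (V : nmodType) (F : R -> V) (A : 'M[R]_(n, l * p)) :
  \sum_(i < l) \sum_(k < \sum_(a < p) n) F (blocks A k i) =
  \sum_(j < l * p) \sum_(c < n) F (A c j).
Proof.
rewrite sum_slots; apply: eq_bigr => i _.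
rewrite sig_big_dep /= (reindex _ tagnat.sig_bij_on) /=.
by apply: eq_bigr => k _; rewrite mxE.
Qed.

Lemma measurable_blocks : measurable_fun [set: 'M[R]_(n, l * p)] blocks.
Proof.
apply/measurable_fun_mxP => k i; under eq_fun do rewrite mxE.
exact: measurable_mx_entry.
Qed.

Lemma measurable_unblocks : measurable_fun [set: 'M[R]_(_, l)] unblocks.
Proof.
apply/measurable_fun_mxP => c j.
rewrite (_ : (fun _ => _) = (fun B : 'M[R]_(_, l) =>
  B (@tagnat.Rank p (fun=> n) (slot_offset j) c) (slot_block j))).
  exact: measurable_mx_entry.
by apply/funext => B; rewrite mxE.
Qed.

End blocks.
Arguments unblocks {R l p} p_gt0 {n} B.

(** Both paddings are zero, so the longer one merely shifts indices. This reconciles the [m] past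
    inputs of the original channel with the whole past block of the other. *)
Lemma column_pad0 (R : realType) (n k m p : nat) (x : 'M[R]_(n, k)) (j : nat) :
  (m <= p)%N ->
  column (row_mx (0 : 'M[R]_(n, p)) x) (p - m + j) =
  column (row_mx (0 : 'M[R]_(n, m)) x) j.
Proof.
move=> mp; have [jm|mj] := ltnP j m.
  by rewrite !column_row_mxl ?column0//; lia.
rewrite -(subnKC mj) column_row_mxr.
have -> : (p - m + (m + (j - m)) = p + (j - m))%N by lia.
exact: column_row_mxr.
Qed.

(** * The block channel computes the blocked output *)

Section DCD_output.
Context d (T : measurableType d) (R : realType) (nt nr m p : nat).
Context (G : int -> nat -> 'M[R]_(nr, nt)) (W : int -> T -> 'cV[R]_nr).
Hypothesis m_lt_p : (m < p)%N.
Hypothesis G_periodic : forall i a tau : nat, (tau <= m)%N ->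
  G (i * p + a)%:Z tau = G a%:Z tau.

Local Notation plc := (Channel m G W).
Local Notation dcd := (DCD m p G W).

Lemma window_DCD (b : int) (l : nat) (w : T) :
  window (DCD_noise p W) b l w =
  blocks (window W (b * p%:Z) (l * p) w).
Proof.
apply/matrixP => k i; rewrite !mxE; congr (W _ w _ 0).
by rewrite mulrDl -addrA /= PoszD PoszM.
Qed.

(** The single zero column on the left stands for the [p] zero columns on the right. *)
Lemma column_blocks (l : nat) (x : 'M[R]_(nt, l * p)) (j : nat) :
  column (row_mx (0 : 'M[R]_(_, 1)) (blocks x)) j =
  \mxcol_(b < p) column (row_mx (0 : 'M[R]_(nt, p)) x) (j * p + b).
Proof.
case: j => [|j].
  rewrite column_row_mxl// column0; apply/matrixP => k i; rewrite !mxE.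
  by rewrite mul0n add0n column_row_mxl// column0 mxE.
rewrite (column_row_mxr (0 : 'M[R]_(_, 1)) (blocks x) j : column _ j.+1 = _).
apply/matrixP => k i; rewrite [RHS]mxE mulSn -addnA column_row_mxr (ord1 i) {i}.
have [jl|lj] := ltnP j l; last first.
  by rewrite !column_geq ?mxE//; nia.
rewrite (column_ord _ (Ordinal jl) : column (blocks x) j = _).
rewrite (column_ord x (slot (Ordinal jl) (tagnat.sig1 k)) :
  column x (j * p + tagnat.sig1 k) = _).
by rewrite !mxE.
Qed.

(** At offset [a], [DCD_gain0] collects the lags inside the current block and [DCD_gain1] those
    reaching the previous one; [sum_wrap] merges them, and periodicity moves the gain from time [a]
    to time [i * p + a]. *)
Lemma signal_DCD (l : nat) (x : 'M[R]_(nt, l * p)) :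
  signal dcd (blocks x) = blocks (signal plc x).
Proof.
apply/matrixP => k i; rewrite !mxE.
set a := tagnat.sig1 k; set c := tagnat.sig2 k.
rewrite [X in fun_of_matrix X k 0 = _](_ : _ =
  DCD_gain0 m p G *m column (row_mx (0 : 'M[R]_(_, 1)) (blocks x)) i.+1 +
  DCD_gain1 m p G *m column (row_mx (0 : 'M[R]_(_, 1)) (blocks x)) i);
  last first.
  rewrite !big_ord_recl big_ord0 addr0 /=.
  by congr (_ *m column _ _ + _ *m column _ _); rewrite /bump /=; lia.
rewrite !column_blocks.
rewrite /DCD_gain0 /DCD_gain1 !mul_mxblock_mxrow 2!mxE [X in _ + X]mxE -/a -/c.
have -> : forall A B : 'cV[R]_nr, A c 0 + B c 0 = (A + B) c 0.
  by move=> A B; rewrite mxE.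
congr (fun_of_matrix _ c 0).
(* With [p] columns of padding, this column is the input at time [i * p + a - tau]. *)
pose H tau := G (a : nat)%:Z tau *m
  column (row_mx (0 : 'M[R]_(nt, p)) x) (p + (i * p + a) - tau).
transitivity (\sum_(tau < m.+1) H tau).
  rewrite -(sum_wrap a H m_lt_p) /H; congr (_ + _); apply: eq_bigr => b _;
    case: ifP => ab; rewrite ?mul0mx//; congr (_ *m column _ _).
    by move/andP: ab => [ba _]; rewrite mulSn; lia.
  by have := ltn_ord b; lia.
apply: eq_bigr => tau _; have tau_m : (tau <= m)%N by rewrite -ltnS.
rewrite /H /= G_periodic//; congr (_ *m _).
by rewrite -(column_pad0 _ _ (ltnW m_lt_p)); congr (column _ _); lia.
Qed.

Lemma output_DCD (l : nat) (x : 'M[R]_(nt, l * p)) (w : T) :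
  output (0 : 'M[R]_(_, memory dcd)) (blocks x) w =
  blocks (output (0 : 'M[R]_(nt, memory plc)) x w).
Proof.
by rewrite !output_from_rest signal_DCD blocksD window_DCD mul0r.
Qed.

End DCD_output.

(** * Transporting codes between the two channels *)

Section code_reshaping.
Context d (T : measurableType d) (R : realType) (P : probability T R).
Context (nt nr m p : nat).
Context (G : int -> nat -> 'M[R]_(nr, nt)) (W : int -> T -> 'cV[R]_nr).
Hypothesis p_gt0 : (0 < p)%N.
Hypothesis m_lt_p : (m < p)%N.
Hypothesis G_periodic : forall i a tau : nat, (tau <= m)%N ->
  G (i * p + a)%:Z tau = G a%:Z tau.
Context (Pow rate : R) (l : nat).

Local Notation plc := (Channel m G W).
Local Notation dcd := (DCD m p G W).

(** The total energy is unchanged, but it is averaged over [l] uses instead of [l * p]. *)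
Lemma average_blocks (M : nat) (x : 'I_M -> 'M[R]_(nt, l * p)) :
  l%:R^-1 * \sum_(i < l) (M%:R^-1 *
    \sum_(u < M) \sum_k blocks (x u) k i ^+ 2) =
  p%:R * ((l * p)%:R^-1 * \sum_(j < l * p) (M%:R^-1 *
    \sum_(u < M) \sum_(a < nt) x u a j ^+ 2)).
Proof.
rewrite -!mulr_sumr exchange_big [in RHS]exchange_big /=.
under eq_bigr do rewrite (sum_blocks p_gt0 (fun y => y ^+ 2)).
rewrite natrM invfM !mulrA; congr (_ * _ * _).
by rewrite mulrAC mulfV ?mul1r// pnatr_eq0 -lt0n.
Qed.

(** Outputs correspond for each [w], so the error events are equal as sets, not just in
    probability. *)
Lemma DCD_code (c : code nt nr Pow rate (l * p)) :
  exists c' : code (\sum_(b < p) nt) (\sum_(a < p) nr)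
      (p%:R * Pow) (p%:R * rate) l,
    mean_error P dcd c' = mean_error P plc c.
Proof.
have rate' : (messages c)%:R = 2 `^ (l%:R * (p%:R * rate)) :> R.
  by rewrite mulrA -natrM code_rate.
have dec' u : measurable ((decoder c \o unblocks p_gt0) @^-1` [set u]).
  rewrite comp_preimage -[X in measurable X]setTI.
  exact: measurable_unblocks (decoder_measurable u).
have pow' : l%:R^-1 * \sum_(i < l) ((messages c)%:R^-1 *
    \sum_(u < messages c) \sum_k blocks (encoder c u) k i ^+ 2) <= p%:R * Pow.
  by rewrite average_blocks ler_wpM2l// code_power.
exists (Code (encoder := fun u => blocks (encoder c u)) rate' dec' pow').
congr (_ * _); apply: eq_bigr => u _; congr (fine (P _)).
apply/seteqP; split => w;
  by rewrite /error_event /= (output_DCD _ m_lt_p G_periodic) blocksK.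
Qed.

Lemma PLC_code (c : code (\sum_(b < p) nt) (\sum_(a < p) nr)
    (p%:R * Pow) rate l) :
  exists c' : code nt nr Pow (rate / p%:R) (l * p),
    mean_error P plc c' = mean_error P dcd c.
Proof.
have p_neq0 : p%:R != 0 :> R by rewrite pnatr_eq0 -lt0n.
have rate' : (messages c)%:R = 2 `^ ((l * p)%:R * (rate / p%:R)) :> R.
  by rewrite natrM mulrACA mulfV// mulr1 code_rate.
have dec' u : measurable ((decoder c \o @blocks R l p nr) @^-1` [set u]).
  rewrite comp_preimage -[X in measurable X]setTI.
  exact: measurable_blocks (decoder_measurable u).
have pow' : (l * p)%:R^-1 * \sum_(j < l * p) ((messages c)%:R^-1 *
    \sum_(u < messages c) \sum_(a < nt)
      unblocks p_gt0 (encoder c u) a j ^+ 2) <= Pow.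
  rewrite -(ler_pM2l (x := p%:R)) ?ltr0n// -average_blocks.
  have := code_power c; congr (_ * _ <= _); apply: eq_bigr => i _.
  congr (_ * _); apply: eq_bigr => u _; apply: eq_bigr => k _.
  by rewrite unblocksK.
exists (Code (encoder := fun u => unblocks p_gt0 (encoder c u))
  rate' dec' pow').
congr (_ * _); apply: eq_bigr => u _; congr (fine (P _)).
apply/seteqP; split => w;
  by rewrite /error_event /= -(output_DCD _ m_lt_p G_periodic) unblocksK.
Qed.

End code_reshaping.

(** * Shift invariance and independence of noise windows *)

Section windows.
Context d (T : measurableType d) (R : realType) (P : probability T R).
Context (n : nat) (W : int -> T -> 'cV[R]_n).

Lemma window_shift (q p k : nat) (B : set 'M[R]_(n, k)) :
  cyclostationary P W q -> (q %| p)%N -> measurable B ->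
  P (window W p%:Z k @^-1` B) = P (window W 0 k @^-1` B).
Proof.
move=> W_cyclo /dvdnP[s ->] mB; elim: s => [//|s IHs].
rewrite -IHs -[RHS]/(P (samples W _ @^-1` B)) -W_cyclo//.
have -> : window W (s.+1 * q)%:Z k =
    samples W (fun j : 'I_k => (s * q)%:Z + (j : nat)%:Z + q%:Z).
  by congr samples; apply/funext => j; rewrite mulSn; lia.
by [].
Qed.

Lemma colsub_window (a b : int) (k l : nat) (f : 'I_k -> 'I_l) w :
  (forall j : 'I_k, a + (j : nat)%:Z = b + (f j : nat)%:Z) ->
  window W a k w = colsub f (window W b l w).
Proof. by move=> ab; apply/matrixP => i j; rewrite !mxE ab. Qed.

Lemma measurable_colsub (k l : nat) (f : 'I_k -> 'I_l) :
  measurable_fun [set: 'M[R]_(n, l)] (colsub f : _ -> 'M[R]_(n, k)).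
Proof.
apply/measurable_fun_mxP => i j; under eq_fun do rewrite mxE.
exact: measurable_mx_entry.
Qed.

(* The dependence condition speaks of nonempty blocks only: an empty one is
   handled by enlarging it away from the other. *)
Lemma window_indep (m : nat) (a b : int) (k l : nat)
    (A : set 'M[R]_(n, k)) (B : set 'M[R]_(n, l)) :
  finitely_dependent P W m -> a + k%:Z + m%:Z <= b ->
  measurable A -> measurable B ->
  P (window W b l @^-1` B `&` window W a k @^-1` A) =
  (P (window W b l @^-1` B) * P (window W a k @^-1` A))%E.
Proof.
move=> W_dep ab mA mB.
have -> : window W a k = colsub (lift ord0) \o window W (a - 1) k.+1.
  by apply/funext => w; apply: colsub_window => j; rewrite lift0; lia.
have -> : window W b l = colsub (widen_ord (leqnSn l)) \o window W b l.+1.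
  by apply/funext => w; exact: colsub_window.
rewrite setIC [RHS]muleC.
(* Enlarged to the left, the first block still ends at [a + k - 1], so the weak inequality assumed
   is the strict one required. *)
have lt_ab : (a - 1) + k%:Z + m%:Z < b by lia.
apply: (W_dep _ _ _ _ lt_ab (colsub (lift ord0) @^-1` A)
  (colsub (widen_ord (leqnSn l)) @^-1` B)).
  by rewrite -[X in measurable X]setTI; exact: measurable_colsub.
by rewrite -[X in measurable X]setTI; exact: measurable_colsub.
Qed.

End windows.

(** * Guard lengths for the two channels *)

Section renewable_channels.
Context d (T : measurableType d) (R : realType) (P : probability T R).
Context (nt nr m q p : nat).
Context (G : int -> nat -> 'M[R]_(nr, nt)) (W : int -> T -> 'cV[R]_nr).
Hypothesis m_lt_p : (m < p)%N.
Hypothesis q_p : (q %| p)%N.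
Hypothesis G_periodic : forall i a tau : nat, (tau <= m)%N ->
  G (i * p + a)%:Z tau = G a%:Z tau.
Hypothesis W_process : random_process W.
Hypothesis W_cyclostationary : cyclostationary P W q.
Hypothesis W_dependence : finitely_dependent P W m.

Lemma renewable_PLC : renewable P (Channel m G W) p.
Proof.
split => //=.
- split; first exact: ltnW.
  by move=> i tau tau_m; rewrite -{1}[p]mul1n G_periodic.
- by move=> l B mB; exact: window_shift q_p mB.
- move=> l A B mA mB; apply: window_indep W_dependence _ mA mB.
  by rewrite /=; lia.
Qed.

(** One block is enough: the state ends at time -1 of the original noise and the kept noise starts
    at time [p], with [m < p]. *)
Lemma renewable_DCD : renewable P (DCD m p G W) 1.
Proof.
have windowE (b : int) l : window (DCD_noise p W) b l =
    @blocks R l p nr \o window W (b * p%:Z) (l * p).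
  by apply/funext => w; exact: window_DCD.
have mblocks l (B : set 'M[R]_(_, l)) : measurable B ->
    measurable (@blocks R l p nr @^-1` B).
  by move=> mB; rewrite -[X in measurable X]setTI; exact: measurable_blocks.
split => //=.
- move=> i; apply/measurable_fun_mxP => k j.
  rewrite (_ : (fun _ => _) =
    (fun w => W (i * p%:Z + (tagnat.sig1 k : nat)%:Z) w (tagnat.sig2 k) j)).
    have := W_process (i * p%:Z + (tagnat.sig1 k : nat)%:Z).
    by move=> /measurable_fun_mxP.
  by apply/funext => w; rewrite mxE.
- move=> l B mB; rewrite !windowE mul1r mul0r.
  exact: (window_shift W_cyclostationary q_p (mblocks _ _ mB)).
- move=> l A B mA mB.
  rewrite /noise_state /= !windowE.
  have le_01 : - 1 * p%:Z + (1 * p)%N%:Z + m%:Z <= 1 * p%:Z by lia.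
  exact: (window_indep W_dependence le_01 (mblocks _ _ mA) (mblocks _ _ mB)).
Qed.

End renewable_channels.

(** * Rates of codes and the cost of idle uses *)

Lemma rate_ge0 (R : realType) (nt nr l : nat) (Pow rate : R)
  (c : code nt nr Pow rate l) : (0 < l)%N -> 0 <= rate.
Proof.
move=> l_gt0; rewrite leNgt; apply/negP => rate_lt0.
(* The decoder returns some message on the zero output, so the message set is nonempty. *)
have M_gt0 : (0 < messages c)%N by case: (messages c) (decoder c 0) => [[]|].
have : 1 <= 2 `^ (l%:R * rate) :> R by rewrite -(code_rate c) ler1n.
have x_lt0 : l%:R * rate < 0 by rewrite pmulr_rlt0// ltr0n.
have x_le1 : 2 `^ (l%:R * rate) <= 1 :> R.
  by rewrite -[leRHS](powRr0 2) ler_powR ?ler1n// ltW.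
move=> x_ge1; have : 2 `^ (l%:R * rate) == 1 :> R.
  by rewrite eq_le x_le1.
by rewrite powR_eq1 pnatr_eq1 ltrn0 (lt_eqF x_lt0).
Qed.

(** Half of [e] is the slack already spent by the code; the other half pays for at most [k] idle
    uses. *)
Lemma rate_loss (R : realType) (a e : R) (k : nat) : 0 < e ->
  exists N : nat, forall l n : nat, (N < l)%N -> (l <= n <= l + k)%N ->
    forall r : R, 0 <= r -> a - e / 2 <= r -> a - e <= l%:R * r / n%:R.
Proof.
(* Beyond this threshold the loss [|a| * k] is at most [l * e / 2]. *)
move=> e_gt0; pose x := `|a| * k%:R * 2 / e.
have x_ge0 : 0 <= x by rewrite /x divr_ge0 ?mulr_ge0// ltW.
exists (Num.bound x) => l n Nl /andP[ln nlk] r r_ge0 ar.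
have n_gt0 : 0 < n%:R :> R by rewrite ltr0n; lia.
rewrite ler_pdivlMr//.
have xl : x <= l%:R.
  by apply: le_trans (ltW (archi_boundP x_ge0)) _; rewrite ler_nat ltnW.
have xe : `|a| * k%:R * 2 <= l%:R * e by rewrite -ler_pdivrMr.
have nl : l%:R <= n%:R :> R by rewrite ler_nat.
have nk : n%:R <= l%:R + k%:R :> R by rewrite -natrD ler_nat.
have k_ge0 : 0 <= k%:R :> R by [].
have l_ge0 : 0 <= l%:R :> R by [].
have aa : a <= `|a| by exact: ler_norm.
(* A nonpositive target is met by any nonnegative rate; a positive one allows [n] to be replaced by
   [l + k]. *)
have [ae|ae] := leP (a - e) 0.
  by apply: (@le_trans _ _ 0); [rewrite mulr_le0_ge0// ltW|rewrite mulr_ge0].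
have bn : (a - e) * n%:R <= (a - e) * (l%:R + k%:R) by rewrite ler_wpM2l// ltW.
have bk : (a - e) * k%:R <= `|a| * k%:R by rewrite ler_wpM2r//; lra.
have bl : (a - e / 2) * l%:R <= r * l%:R by rewrite ler_wpM2r.
lra.
Qed.

(** * Achievable rates and capacities *)

Section capacity_of_blocks.
Context d (T : measurableType d) (R : realType) (P : probability T R).
Context (nt nr m q p : nat).
Context (G : int -> nat -> 'M[R]_(nr, nt)) (W : int -> T -> 'cV[R]_nr).
Variable Pow : R.
Hypothesis m_lt_p : (m < p)%N.
Hypothesis q_p : (q %| p)%N.
Hypothesis G_periodic : forall i a tau : nat, (tau <= m)%N ->
  G (i * p + a)%:Z tau = G a%:Z tau.
Hypothesis W_process : random_process W.
Hypothesis W_cyclostationary : cyclostationary P W q.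
Hypothesis W_dependence : finitely_dependent P W m.

Let p_gt0 : (0 < p)%N. Proof. exact: leq_ltn_trans m_lt_p. Qed.
Let pR_gt0 : 0 < p%:R :> R. Proof. by rewrite ltr0n. Qed.
Let pR_neq0 : p%:R != 0 :> R. Proof. by rewrite gt_eqF. Qed.
Let ren_PLC : renewable P (Channel m G W) p.
Proof. exact: renewable_PLC q_p _ _ _ _. Qed.
Let ren_DCD : renewable P (DCD m p G W) 1.
Proof. exact: renewable_DCD q_p _ _ _. Qed.

Lemma achievable_DCD (Rc : R) : achievable P (Channel m G W) Pow Rc ->
  achievable P (DCD m p G W) (p%:R * Pow) (p%:R * Rc).
Proof.
move=> ach e1 e2 e1_gt0 e2_gt0.
(* Blocking multiplies the rate slack by [p], giving [e2 / 2]; the guard uses the other half. *)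
have e2'_gt0 : 0 < e2 / 2 / p%:R by rewrite !divr_gt0.
have [l0 l0_gt0 codes] := ach _ _ e1_gt0 e2'_gt0.
have [N loss] := rate_loss (p%:R * Rc) 1 e2_gt0.
exists (l0 + N).+2 => // l l_large.
(* One guard block, [k] code blocks and no trailing padding. *)
have [k [lE kl0 kN]] : exists k, [/\ l = (1 + k + 0)%N, (l0 < k)%N & (N < k)%N].
  by exists l.-1; split; lia.
subst l; have k_gt0 : (0 < k)%N by lia.
have kp : (l0 < k * p)%N by nia.
have [rate [c [c_err c_rate]]] := codes _ kp.
have [c1 c1E] := DCD_code P W p_gt0 m_lt_p G_periodic c.
have [c2 c2_err] := guard_code 0 ren_DCD c1 k_gt0.
exists _, c2; split.
  apply: le_lt_trans c2_err _; rewrite c1E; apply: le_lt_trans c_err.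
  by apply: mean_error_le_worst; case: ren_PLC.
apply: loss => //; first by lia.
  exact: rate_ge0 c1 k_gt0.
rewrite (_ : p%:R * Rc - e2 / 2 = p%:R * (Rc - e2 / 2 / p%:R)).
  by rewrite ler_pM2l.
by rewrite mulrBr mulrCA divff ?mulr1// mulrC.
Qed.

Lemma achievable_PLC (Rc : R) :
  achievable P (DCD m p G W) (p%:R * Pow) Rc ->
  achievable P (Channel m G W) Pow (Rc / p%:R).
Proof.
move=> ach e1 e2 e1_gt0 e2_gt0.
have e2'_gt0 : 0 < p%:R * (e2 / 2) by rewrite mulr_gt0 ?divr_gt0.
have [l0 l0_gt0 codes] := ach _ _ e1_gt0 e2'_gt0.
(* The guard takes [p] uses and the remainder fewer than [p], hence the bound [2 * p]. *)
have [N loss] := rate_loss (Rc / p%:R) (2 * p) e2_gt0.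
exists ((l0 + N + 3) * p)%N => [|n n_large]; first by nia.
(* An arbitrary length is a guard of one period, [k] full blocks and a remainder of idle uses. *)
have [k [r [nE kl0 kN rp]]] : exists k r,
    [/\ n = (p + k * p + r)%N, (l0 < k)%N, (N < k)%N & (r < p)%N].
  have nE := divn_eq n p; have np := ltn_pmod n p_gt0.
  exists (n %/ p).-1, (n %% p)%N.
  have q_large : (l0 + N + 3 <= n %/ p)%N by rewrite leq_divRL// ltnW.
  split; [|lia..|exact: np].
  rewrite {1}nE; case: (n %/ p)%N q_large => [|t] /=; nia.
subst n; have k_gt0 : (0 < k)%N by lia.
have [rate [c [c_err c_rate]]] := codes _ kl0.
have kp_gt0 : (0 < k * p)%N by nia.
have [c1 c1E] := PLC_code P W p_gt0 m_lt_p G_periodic c.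
have [c2 c2_err] := guard_code r ren_PLC c1 kp_gt0.
exists _, c2; split.
  apply: le_lt_trans c2_err _; rewrite c1E; apply: le_lt_trans c_err.
  by apply: mean_error_le_worst; case: ren_DCD.
apply: loss; [nia|nia| |].
  exact: rate_ge0 c1 kp_gt0.
by rewrite ler_pdivlMr// mulrBl divfK// [e2 / 2 * _]mulrC.
Qed.

(** Scaling by [p] carries achievable rates to achievable rates in both directions; comparing
    suprema in the extended reals needs no case on finiteness. *)
Lemma capacity_blocks : capacity P (Channel m G W) Pow =
  ((p%:R^-1)%:E * capacity P (DCD m p G W) (p%:R * Pow))%E.
Proof.
apply/eqP; rewrite eq_le; apply/andP; split.
  apply: ub_ereal_sup => _ [Rc /achievable_DCD ach <-].
  rewrite lee_pdivlMl//; apply: ereal_sup_ubound.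
  by exists (p%:R * Rc).
rewrite lee_pdivrMl//; apply: ub_ereal_sup => _ [Rc /achievable_PLC ach <-].
rewrite -lee_pdivrMl// -EFinM; apply: ereal_sup_ubound.
by exists (Rc / p%:R) => //; rewrite mulrC.
Qed.

End capacity_of_blocks.

Theorem theorem1 (R : realType) (d : measure_display) (T : measurableType d)
    (P : probability T R) (nt nr m pG pW p : nat)
    (G : int -> nat -> 'M[R]_(nr, nt)) (W : int -> T -> 'cV[R]_nr) (Pow : R)
    (nt_gt0 : (0 < nt)%N) (nr_gt0 : (0 < nr)%N)
    (pG_gt0 : (0 < pG)%N) (pW_gt0 : (0 < pW)%N)
    (G_periodic : forall (i : int) (tau : nat), (tau <= m)%N ->
       G i tau = G (i + pG%:Z) tau)
    (W_process : random_process W)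
    (W_zero_mean : zero_mean P W)
    (W_cyclostationary : cyclostationary P W pW)
    (W_dependence : finitely_dependent P W m)
    (W_irredundant : linearly_irredundant P W)
    (p_common : (pG %| p)%N /\ (pW %| p)%N) (p_gt_m : (m < p)%N)
    (p_minimal : forall q : nat,
       (pG %| q)%N -> (pW %| q)%N -> (m < q)%N -> (p <= q)%N) :
  capacity P (Channel m G W) Pow =
  ((p%:R^-1)%:E * capacity P (DCD m p G W) (p%:R * Pow))%E.
Proof.
case: p_common => pG_p pW_p.
apply: (capacity_blocks _ p_gt_m pW_p) => // i a tau tau_m.
(* The shift [i * p] is a whole number [s] of gain periods; induction removes them one at a time. *)
have /dvdnP[s ->] : (pG %| i * p)%N by exact: dvdn_mull.
elim: s => [|s IHs]; first by rewrite mul0n.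
rewrite -IHs [RHS]G_periodic//; congr (G _ tau).
by rewrite mulSn; lia.
Qed.
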